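(* Let $d\in\{2,3\}$ and $\omega\in C^2(\mathbb{R}^d_*,\mathbb{R})$. Assume that there exist $i,j\in\{1,\ldots,d\}$, $i\neq j$, such that the functions $1,\partial_i\omega,\partial_j\omega$ are linearly independent in $C^1(\mathbb{R}^d_* )$. Let $g\in C^1(\mathbb{R}^d_*,\mathbb{R})$ be such that $$g(v')+g(v'_* )=g(v)+g(v_* )$$ for all $v,v_*,v',v'_*\in\mathbb{R}^d_*$ satisfying $$v+v_*=v'+v'_*\quad\text{and}\quad \omega(v)+\omega(v_* )=\omega(v')+\omega(v'_* ).$$ Then there exist $a,c\in\mathbb{R}$ and $b\in\mathbb{R}^d$ such that, for all $v\in\mathbb{R}^d_*$, $$g(v)=a+b\cdot v+c\,\omega(v).$$
   Context: Notation: $\mathbb{R}^d_*:=\mathbb{R}^d\setminus\{0\}$. Here $1$ denotes the constant function equal to $1$, and linear independence is over $\mathbb{R}$. *)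

(* Defs.v *)
From mathcomp Require Import all_boot all_order all_algebra.
From mathcomp Require Import all_classical all_reals all_analysis.
Import Order.TTheory GRing.Theory Num.Theory numFieldNormedType.Exports.

Set Implicit Arguments.
Unset Strict Implicit.
Unset Printing Implicit Defensive.

Local Open Scope ring_scope.
Local Open Scope classical_set_scope.

Definition punctured (R : realType) (d : nat) : set 'rV[R]_d := ~` [set 0].

Definition partial (R : realType) (d : nat) (i : 'I_d) (f : 'rV[R]_d -> R) :
  'rV[R]_d -> R := fun x => 'D_(delta_mx 0 i) f x.

(* A function on a subset U is represented by a total function whose values
   off U are irrelevant.  This definition is meant for open U, for which
   derivability and continuity at a point of U only depend on f restricted
   to U. *)
Fixpoint is_Ck (R : realType) (d k : nat) (U : set 'rV[R]_d)
    (f : 'rV[R]_d -> R) : Prop :=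
  (forall x, U x -> {for x, continuous f}) /\
  if k is k'.+1 then
    forall i : 'I_d, (forall x, U x -> derivable f x (delta_mx 0 i)) /\
                     is_Ck k' U (partial i f)
  else True.

(* The functions are compared on U only, that is, as elements of a space of
   functions with domain U; [free] from vector.v is not applicable, since that
   space is infinite-dimensional. *)
Definition linearly_independent_on (R : realType) (T : Type) (U : set T)
    (n : nat) (f : n.-tuple (T -> R)) : Prop :=
  forall a : 'I_n -> R,
    (forall x, U x -> \sum_(k < n) a k * tnth f k x = 0) ->
    forall k, a k = 0.

(* Main.v *)
From HB Require Import structures.
Require Import Defs.
From mathcomp Require Import all_boot all_order all_algebra.
From mathcomp Require Import all_classical all_reals all_analysis.
From mathcomp Require Import ring lra.
Import Order.TTheory GRing.Theory Num.Theory numFieldNormedType.Exports.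
Local Open Scope ring_scope.
Local Open Scope classical_set_scope.

(** Fix a total momentum [p].  Conservation says that [g v + g (p - v)] is
    constant on the level sets of [omega v + omega (p - v)], so the gradients of
    these two functions of [v] are parallel.  At [v], with [w = p - v], these
    gradients are [grad g v - grad g w] and [grad omega v - grad omega w].  As
    [p] is arbitrary, the increments of [grad g] are therefore parallel to those
    of [grad omega] between any two nonzero points
    ([collision_derivatives_parallel]).  Parallelism is expressed by the
    vanishing of the 2 x 2 minors, which holds trivially at critical points, so
    no regularity of the level sets has to be assumed.

    Linear independence of [1], [partial i omega] and [partial j omega] gives
    three points at which the values of [grad omega] are not collinear
    ([noncollinear_triple]).  Along the sides of a nondegenerate triangle the
    three proportionality factors coincide, with common value [c], say.  Then
    [grad g - c grad omega] takes the same value at the three points, and at any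
    fourth point too: its deviation from that value would be parallel to three
    directions that are not all parallel ([parallel_increments_affine]).

    Hence [g - c omega] has constant partial derivatives, and is affine on the
    punctured space, any two points of which are joined by axis-parallel lines
    that avoid the origin as soon as there are two coordinates
    ([punctured_affine]).

    The step from level sets to gradients needs no implicit function theorem.
    If [w] is a direction along which [f] increases and [u] is tangent to the
    level set, the intermediate value theorem on the segment from
    [u - e w] to [u + e w], scaled down to a small size, finds a point of the
    level set in a direction as close to [u] as desired
    ([level_set_tangent]). *)

Set Implicit Arguments.
Unset Strict Implicit.

(** * Differentiability of functions with continuous partial derivatives *)

Lemma is_derive_line (R : realType) (V W : normedModType R) (f : V -> W)
    (x v : V) (t : R) :
  derivable f (x + t *: v) v ->
  is_derive t 1 (fun s : R => f (x + s *: v)) ('D_v f (x + t *: v)).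
Proof.
move=> df.
have quotE : (fun h : R => h^-1 *: (((fun s : R => f (x + s *: v)) \o shift t)
      (h *: 1) - f (x + t *: v))) =
    (fun h : R => h^-1 *: ((f \o shift (x + t *: v)) (h *: v)
      - f (x + t *: v))).
  apply/funext => h /=; congr (_ *: (f _ - _)).
  by rewrite [h *: 1]mulr1 scalerDl addrCA.
by apply: DeriveDef; rewrite /derivable /derive quotE.
Qed.

(** Allowing [a] of either sign is what makes this usable for increments of a
    coordinate, whose sign is unknown. *)
Lemma line_mean_value (R : realType) (V : normedModType R) (f : V -> R)
    (x v : V) (a : R) :
  (forall t : R, `|t| <= `|a| -> derivable f (x + t *: v) v) ->
  exists2 c : R, `|c| <= `|a| &
    f (x + a *: v) - f x = a * 'D_v f (x + c *: v).
Proof.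
move=> df.
pose phi (s : R) := f (x + s *: v).
have dphi (t : R) : `|t| <= `|a| -> is_derive t 1 phi ('D_v f (x + t *: v)).
  by move=> ta; apply/is_derive_line/df.
have mvt (l r : R) : l <= r -> (forall t, t \in `[l, r]%R -> `|t| <= `|a|) ->
    exists2 c : R, `|c| <= `|a| &
      phi r - phi l = 'D_v f (x + c *: v) * (r - l).
  move=> lr lra; have [||c /lra ca fE] := MVT_segment lr (f := phi)
    (df := fun t => 'D_v f (x + t *: v)).
  - by move=> t /subset_itv_oo_cc /lra ta; apply: dphi.
  - by apply: derivable_within_continuous => t /lra /dphi[].
  - by exists c.
have phi0 : phi 0 = f x by rewrite /phi scale0r addr0.
case: (leP 0 a) => [a0|/ltW a0].
- have [t|c ca] := mvt 0 a a0.
    by rewrite in_itv /= => /andP[t0 ta]; rewrite !ger0_norm.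
  by rewrite phi0 subr0 mulrC => fE; exists c.
- have [t|c ca] := mvt a 0 a0.
    by rewrite in_itv /= => /andP[ta t0]; rewrite !ler0_norm// lerN2.
  rewrite phi0 sub0r => fE.
  by exists c => //; rewrite -opprB fE mulrN opprK mulrC.
Qed.

Lemma differentiable_remainder_le (R : realType) (V W : normedModType R)
    (f : V -> W) (x : V) :
  differentiable f x -> forall e : R, 0 < e ->
  \forall h \near 0, `|f (x + h) - f x - 'd f x h| <= e * `|h|.
Proof.
move=> /diff_locally/eqaddoP dfx e e0.
have := dfx e e0; apply: filterS => h /=.
by rewrite -![(_ + _ : _ -> _) _]/(_ + _) -![(- _ : _ -> _) _]/(- _) /= opprD
  addrA (addrC h).
Qed.

Lemma remainder_le_differentiable (R : realType) (V W : normedModType R)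
    (f : V -> W) (x : V) (df : {linear V -> W}) :
  continuous df ->
  (forall e : R, 0 < e ->
     \forall h \near 0, `|f (x + h) - f x - df h| <= e * `|h|) ->
  differentiable f x.
Proof.
move=> dfc fdf.
have fE : f \o shift x = cst (f x) + df +o_ 0 id.
  apply/eqaddoP => e e0; have := fdf e e0; apply: filterS => h /=.
  by rewrite -![(_ + _ : _ -> _) _]/(_ + _) -![(- _ : _ -> _) _]/(- _) /= opprD
  addrA (addrC h).
have dE := diff_unique dfc fE.
by apply/diff_locallyP; rewrite dE.
Qed.

Lemma rV_norm_le (R : realType) (d : nat) (x : 'rV[R]_d) (r : R) :
  0 <= r -> (forall k, `|x 0 k| <= r) -> `|x| <= r.
Proof.
move=> r0 xr; rewrite /Num.norm /= mx_normrE.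
by apply: bigmax_le => // -[i k] _; rewrite (ord1 i).
Qed.

Lemma rV_coord_le (R : realType) (d : nat) (x : 'rV[R]_d) (k : 'I_d) :
  `|x 0 k| <= `|x|.
Proof.
by rewrite [leRHS]/Num.norm /= mx_normrE; apply: (le_bigmax _ _ (0, k)).
Qed.

(** The increment [h] is added one coordinate at a time.  Each of the [d] moves
    is controlled by the mean value theorem at a point within [`|h|] of [x],
    where the partial derivatives are close to those at [x]. *)
Lemma is_C1_differentiable (R : realType) (d : nat) (U : set 'rV[R]_d)
    (f : 'rV[R]_d -> R) (x : 'rV[R]_d) :
  open U -> is_Ck 1 U f -> U x -> differentiable f x.
Proof.
move=> oU [_ C1f] Ux.
pose df (h : 'rV[R]_d) : R := \sum_(k < d) h 0 k * partial k f x.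
have df_lin : linear df.
  move=> a u v; rewrite /df scaler_sumr -big_split; apply: eq_bigr => k _.
  by rewrite !mxE mulrDl -mulrA.
have df_cont : continuous df.
  apply: continuous_big => [|k _ h]; first exact: add_continuous.
  apply: (@continuous_comp _ _ _ (fun M : 'rV[R]_d => M 0 k) ( *%R^~ _)).
    exact: coord_continuous.
  exact: mulrr_continuous.
pose dfL := GRing.isLinear.Build R _ _ _ df df_lin.
pose dfl : {linear 'rV[R]_d -> R} := HB.pack df dfL.
apply: (@remainder_le_differentiable R 'rV[R]_d R f x dfl) => // e e0.
(* Dividing by [d.+1] instead of [d] covers dimension 0. *)
pose e' := e / d.+1%:R.
have e'0 : 0 < e' by rewrite divr_gt0.
have close : \forall y \near x,
    U y /\ forall k, `|partial k f y - partial k f x| <= e'.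
  apply: filterI; first exact: open_nbhs_nbhs.
  apply: (@filter_forall _ _ _ _ (nbhs_filter x)) => k.
  have [_ [/(_ x Ux) pk _]] := C1f k.
  by have /cvgrPdistC_le := pk; apply.
have [r /= r0 rP] := (nbhs_normP _ _).1 close.
apply/nbhs_normP; exists r => //= h.
rewrite /ball_ /= sub0r normrN => hr.
pose y (m : nat) : 'rV[R]_d := x + \row_k (if (k < m)%N then h 0 k else 0).
have yS (k : 'I_d) : y k.+1 = y k + h 0 k *: delta_mx 0 k.
  rewrite /y -addrA; congr (_ + _); apply/rowP => l; rewrite !mxE eqxx /=.
  rewrite ltnS leq_eqVlt; case: eqVneq => [/val_inj ->|]; rewrite /= ?ltnn.
    by rewrite add0r eqxx mulr1.
  by move=> /negPf lk; rewrite -val_eqE lk mulr0 addr0.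
have near_y (k : 'I_d) (t : R) : `|t| <= `|h 0 k| ->
    ball_ Num.norm x r (y k + t *: delta_mx 0 k).
  move=> th; rewrite /ball_ /= distrC; apply: le_lt_trans hr.
  rewrite /y -[x + _ + _]addrA [x + _]addrC addrK; apply: rV_norm_le => // l.
  rewrite !mxE eqxx /=.
  case: eqVneq => [->|_]; rewrite ?ltnn ?add0r ?mulr1 ?mulr0 ?addr0.
    exact/(le_trans th)/rV_coord_le.
  by case: ifP => _; rewrite ?normr0 ?rV_coord_le.
have step (k : 'I_d) :
    `|f (y k.+1) - f (y k) - h 0 k * partial k f x| <= e' * `|h|.
  have [t th|c ch] := @line_mean_value R _ f (y k) (delta_mx 0 k) (h 0 k).
    by have [/(_ _ (rP _ (near_y _ _ th)).1)] := C1f k.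
  rewrite -yS => ->; rewrite -mulrBr normrM mulrC.
  by apply: ler_pM => //; [apply: (rP _ (near_y _ _ ch)).2|apply: rV_coord_le].
have y0 : y 0%N = x.
  by rewrite /y; apply/rowP => k; rewrite !mxE addr0.
have yd : y d = x + h.
  by rewrite /y; congr (_ + _); apply/rowP => k; rewrite !mxE ltn_ord.
rewrite -yd -y0 -(telescope_sumr (fun m => f (y m)))// big_mkord /=.
rewrite /df -sumrB; apply: le_trans (ler_norm_sum _ _ _) _.
apply: le_trans (ler_sum _ (fun k _ => step k)) _.
rewrite sumr_const card_ord -mulrnAl ler_wpM2r//.
by rewrite /e' -mulr_natr mulrAC ler_pdivrMr// ler_wpM2l ?ltW// ltr_nat.
Qed.

(** * Functions constant on level sets *)

(** For small [s > 0], [f] takes values on both sides of [f x] at the ends of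
    the segment [x + s (u + t w)], [-e <= t <= e], so the level set of [f] meets
    it.  There [h] equals [h x], which bounds ['d h x u] by a multiple of [e].
    The hypothesis on [w] is essential: at a critical point of [f] every
    direction is in the kernel of ['d f x], while [h] may vary. *)
Lemma level_set_tangent (R : realType) (V : normedModType R) (f h : V -> R)
    (x u w : V) :
  differentiable f x -> differentiable h x ->
  (\forall y \near x, {for y, continuous f}) ->
  (\forall y \near x, f y = f x -> h y = h x) ->
  'd f x w != 0 -> 'd f x u = 0 -> 'd h x u = 0.
Proof.
move=> df dh cf fh.
wlog dfw : w / 0 < 'd f x w.
  move=> wlog_w dfw; case: (ltrP 0 ('d f x w)) => [w0|].
    exact: (wlog_w w).
  rewrite le_eqVlt (negPf dfw)/= => w0.
  by apply: (wlog_w (- w)); rewrite linearN ?oppr_gt0 ?oppr_eq0.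
move=> _ dfu.
(* Adding 1 keeps [N] positive even if [u] and [w] vanish, and the bound on the
   segment strict. *)
pose N := `|u| + `|w| + 1.
have N0 : 0 < N by rewrite ltr_wpDl// addr_ge0.
have segment_norm (e t : R) : e <= 1 -> `|t| <= e -> `|u + t *: w| < N.
  move=> e1 te; apply: le_lt_trans (ler_normD _ _) _.
  rewrite normrZ /N -addrA ltrD2l.
  apply: (@le_lt_trans _ _ `|w|); last by rewrite ltrDl.
  by rewrite ler_piMl// (le_trans te).
have bound (e : R) : 0 < e -> e <= 1 -> `|'d h x u| <= e * (`|'d h x w| + N).
  move=> e0 e1.
  (* With this accuracy, the error in [f] at [x + s (u +- e w)] cannot exceed
     the first-order change [+- s e 'd f x w], so [f] takes values on both
     sides of [f x]. *)
  have eta0 : 0 < e * 'd f x w / N by rewrite divr_gt0// mulr_gt0.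
  have [r r0 rP] : exists2 r : R, 0 < r & forall y, `|y| < r ->
     [/\ `|f (x + y) - f x - 'd f x y| <= e * 'd f x w / N * `|y|,
         `|h (x + y) - h x - 'd h x y| <= e * `|y|,
         {for (x + y), continuous f} &
         f (x + y) = f x -> h (x + y) = h x].
    have [r1 /= r10 r1P] :=
      (nbhs_normP _ _).1 (differentiable_remainder_le df eta0).
    have [r2 /= r20 r2P] :=
      (nbhs_normP _ _).1 (differentiable_remainder_le dh e0).
    have [r3 /= r30 r3P] := (nbhs_normP _ _).1 cf.
    have [r4 /= r40 r4P] := (nbhs_normP _ _).1 fh.
    exists (Num.min (Num.min r1 r2) (Num.min r3 r4)).
      by rewrite !lt_min r10 r20 r30.
    move=> y; rewrite !lt_min => /andP[/andP[y1 y2] /andP[y3 y4]].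
    split; [apply: r1P|apply: r2P|apply: r3P|apply: r4P];
      by rewrite /ball_ /= ?sub0r ?opprD ?addNKr ?normrN.
  pose s := r / N.
  have s0 : 0 < s by rewrite divr_gt0.
  pose p (t : R) := s *: (u + t *: w).
  have pr (t : R) : `|t| <= e -> `|p t| < r.
    move=> te; rewrite normrZ gtr0_norm// mulrC -ltr_pdivlMr//.
    by rewrite /s invf_div mulrC divfK ?gt_eqF// (segment_norm e).
  have dfp (t : R) : 'd f x (p t) = s * (t * 'd f x w).
    by rewrite !linearZ linearD linearZ /= dfu add0r.
  have err (t : R) : `|t| <= e ->
      `|f (x + p t) - f x - s * (t * 'd f x w)| <= s * (e * 'd f x w).
    move=> te; have [fp _ _ _] := rP _ (pr _ te).
    rewrite -dfp; apply: le_trans fp _.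
    rewrite normrZ gtr0_norm// mulrCA (ler_wpM2l (ltW s0))//.
    rewrite mulrAC ler_pdivrMr// (ler_wpM2l (ltW (mulr_gt0 e0 dfw)))//.
    exact/ltW/(segment_norm e).
  have [t tI ft] : exists2 t, t \in `[- e, e]%R & f (x + p t) = f x.
    apply: IVT; first by rewrite ge0_cp// ?ltW.
      apply: continuous_in_subspaceT => t.
      rewrite inE /= in_itv /= -ler_norml => te.
      have [_ _ fc _] := rP _ (pr _ te).
      apply: (@continuous_comp _ _ _ (fun t => x + p t) f); last exact: fc.
      apply: cvgD; first exact: cvg_cst.
      apply: cvgZl_tmp; apply: cvgD; first exact: cvg_cst.
      by apply: cvgZr_tmp; exact: cvg_id.
    have := err e; rewrite gtr0_norm// lexx => /(_ isT).
    have := err (- e); rewrite normrN gtr0_norm// lexx => /(_ isT).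
    rewrite !ler_norml ge_min le_max => /andP[_ a1] /andP[a2 _].
    by apply/andP; split; apply/orP; [left|right]; lra.
  have te : `|t| <= e by move: tI; rewrite in_itv /= -ler_norml.
  have [_ hp _ /(_ ft) ht] := rP _ (pr _ te).
  move: hp; rewrite ht subrr sub0r normrN linearZ linearD linearZ /=.
  rewrite normrZ [`|p t|]normrZ gtr0_norm// mulrCA ler_pM2l// => hp.
  have hp' : `|'d h x u + t *: 'd h x w| <= e * N.
    by apply: le_trans hp _; exact/(ler_wpM2l (ltW e0))/ltW/(segment_norm e).
  rewrite -['d h x u](addrK (t *: 'd h x w)) mulrDr [leRHS]addrC.
  apply: le_trans (ler_normB _ _) _; apply: lerD => //.
  by rewrite normrZ ler_wpM2r.
apply/eqP; rewrite -normr_le0; apply/ler_addgt0Pl => e e0; rewrite addr0.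
(* The factor [e / (C + e)] is at most 1, and [C] times it is at most [e]. *)
set C := _ + N in bound.
have C0 : 0 < C by rewrite ltr_wpDl.
have Ce0 : 0 < C + e by rewrite addr_gt0.
apply: le_trans (bound (e / (C + e)) _ _) _; first by rewrite divr_gt0.
  by rewrite (ler_pdivrMr _ _ Ce0) mul1r lerDr ltW.
by rewrite mulrAC (ler_pdivrMr _ _ Ce0) (ler_wpM2l (ltW e0))// lerDl ltW.
Qed.

(** If [df u] is not 0, the vector [df u *: w - df w *: u] is in the kernel of
    [df], hence in that of [dh].  At a critical point both sides are 0. *)
Lemma level_set_proportional (R : realType) (V : normedModType R)
    (f h df dh : V -> R) (x u w : V) :
  is_diff x f df -> is_diff x h dh ->
  (\forall y \near x, {for y, continuous f}) ->
  (\forall y \near x, f y = f x -> h y = h x) ->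
  df u * dh w = df w * dh u.
Proof.
move=> [fx <-] [hx <-] cf fh; have tangent := level_set_tangent fx hx cf fh.
case: (eqVneq ('d f x u) 0) => [fu|fu].
  case: (eqVneq ('d f x w) 0) => [->|fw]; first by rewrite fu !mul0r.
  by rewrite fu (tangent u w)// mul0r mulr0.
have dE (F : {linear V -> R}) (a b : R) :
    F (a *: w - b *: u) = a * F w - b * F u.
  by rewrite linearB !linearZ.
apply/eqP; rewrite -subr_eq0 -dE; apply/eqP/(tangent _ u) => //.
by rewrite dE mulrC subrr.
Qed.

(** * Gradients of collision invariants *)

Lemma punctured_open (R : realType) (d : nat) : open (@punctured R d).
Proof.
apply: closed_openC; apply: accessible_closed_set1.
exact/hausdorff_accessible/norm_hausdorff.
Qed.

Lemma near_reflection (R : realType) (V : normedModType R) (U : set V)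
    (p v : V) :
  open U -> U v -> U (p - v) -> \forall y \near v, U y /\ U (p - y).
Proof.
move=> oU Uv Upv; apply: filterI; first exact: open_nbhs_nbhs.
have refl : p - y @[y --> v] --> p - v.
  by apply: cvgB; [exact: cvg_cst|exact: cvg_id].
by apply: refl; apply: open_nbhs_nbhs.
Qed.

Lemma is_diff_pair_sum (R : realType) (V : normedModType R) (f : V -> R)
    (p v : V) :
  differentiable f v -> differentiable f (p - v) ->
  is_diff v (fun y => f y + f (p - y)) (fun u => 'd f v u - 'd f (p - v) u).
Proof.
move=> fv fpv.
have refl : is_diff v (fun y => p - y) (fun u => - u).
  have -> : (fun y : V => p - y) = cst p - id by [].
  apply: is_diff_eq; apply/funext => u; exact: sub0r.
have fv' : is_diff v f ('d f v) by split.
have fpv' : is_diff (p - v) f ('d f (p - v)) by split.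
have -> : (fun y => f y + f (p - y)) = f + (f \o (fun y => p - y)) by [].
apply: is_diff_eq; apply/funext => u.
by rewrite -[LHS]/('d f v u + 'd f (p - v) (- u)) linearN.
Qed.

(** With [p = v + w] fixed, [y |-> h y + h (p - y)] is constant on the level
    sets of [y |-> f y + f (p - y)] near [v]. *)
Lemma collision_derivatives_parallel (R : realType) (V : normedModType R)
    (U : set V) (f h : V -> R) :
  open U -> (forall x, U x -> differentiable f x) ->
  (forall x, U x -> differentiable h x) ->
  (forall v w v' w', U v -> U w -> U v' -> U w' -> v + w = v' + w' ->
    f v + f w = f v' + f w' -> h v' + h w' = h v + h w) ->
  forall v w a b, U v -> U w ->
  ('D_a f v - 'D_a f w) * ('D_b h v - 'D_b h w) =
  ('D_b f v - 'D_b f w) * ('D_a h v - 'D_a h w).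
Proof.
move=> oU df dh cons v w a b Uv Uw.
pose p := v + w; have pv : p - v = w by rewrite /p addrC addKr.
have near_U : \forall y \near v, U y /\ U (p - y).
  by apply: near_reflection; rewrite ?pv.
have dsum (k : V -> R) : (forall x, U x -> differentiable k x) ->
    is_diff v (fun y => k y + k (p - y)) (fun u => 'd k v u - 'd k w u).
  move=> dk; have := @is_diff_pair_sum _ _ k p v (dk _ Uv).
  by rewrite pv; apply; apply: dk.
rewrite (deriveE a (df _ Uv)) (deriveE a (df _ Uw)).
rewrite (deriveE b (df _ Uv)) (deriveE b (df _ Uw)).
rewrite (deriveE a (dh _ Uv)) (deriveE a (dh _ Uw)).
rewrite (deriveE b (dh _ Uv)) (deriveE b (dh _ Uw)).
have cF : \forall y \near v, {for y, continuous (fun y => f y + f (p - y))}.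
  apply: filterS near_U => y [Uy Upy].
  have [dS _] := is_diff_pair_sum (df _ Uy) (df _ Upy).
  exact: differentiable_continuous dS.
have FH : \forall y \near v, f y + f (p - y) = f v + f (p - v) ->
    h y + h (p - y) = h v + h (p - v).
  apply: filterS near_U => y [Uy Upy] fy; apply/esym/cons => //.
    by rewrite pv.
  by rewrite [LHS]addrC subrK [RHS]addrC subrK.
exact: level_set_proportional (dsum f df) (dsum h dh) cF FH.
Qed.

(** * Families of vectors with parallel increments *)

(** If all the values of [(p, q)] were on one line, the equation of that line
    would be a linear relation between [1], [p] and [q]. *)
Lemma noncollinear_triple (R : realType) (T : Type) (U : set T) (p q : T -> R) :
  linearly_independent_on U [tuple (fun _ => 1); p; q] ->
  exists u0 u1 u2, [/\ U u0, U u1, U u2 &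
    (p u1 - p u0) * (q u2 - q u0) != (q u1 - q u0) * (p u2 - p u0)].
Proof.
move=> indep.
have free3 (a b c : R) : (forall x, U x -> a + b * p x + c * q x = 0) ->
    [/\ a = 0, b = 0 & c = 0].
  move=> abc; pose t := [tuple a; b; c].
  have t0 := indep (tnth t); rewrite /t in t0.
  have {}t0 k : tnth [tuple a; b; c] k = 0.
    apply: t0 => x Ux; rewrite !big_ord_recl big_ord0 -[RHS](abc x Ux).
    by rewrite !(tnth_nth 0) /= mulr1 addr0 addrA.
  by split; [have := t0 0|have := t0 1|have := t0 2%:R]; rewrite (tnth_nth 0).
have [u0 Uu0] : exists u, U u.
  apply: contrapT => U0; have [x Ux|/eqP] := free3 1 0 0.
    by case: U0; exists x.
  by rewrite oner_eq0.
have [u1 [Uu1 p10]] : exists u, U u /\ p u - p u0 != 0.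
  apply: contrapT => p0; have [x Ux|_ /eqP] := free3 (- p u0) 1 0.
    rewrite mul1r mul0r addr0 addrC; apply/eqP/negP => /negP px.
    by apply: p0; exists x.
  by rewrite oner_eq0.
apply: contrapT => none.
have [x Ux|_ _ p0] := free3
    ((q u1 - q u0) * p u0 - (p u1 - p u0) * q u0)
    (- (q u1 - q u0)) (p u1 - p u0); last by rewrite p0 eqxx in p10.
have /eqP : (p u1 - p u0) * (q x - q u0) == (q u1 - q u0) * (p x - p u0).
  by apply/negPn/negP => pq; apply: none; exists u0, u1, x.
by move/eqP; lra.
Qed.

Lemma parallel_proportional (K : fieldType) (I : Type) (a b : I -> K) (m : I) :
  a m != 0 -> (forall k l, a k * b l = a l * b k) ->
  exists c, forall k, b k = c * a k.
Proof.
move=> am ab; exists (b m / a m) => k; apply: (mulfI am).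
by rewrite ab mulrA [a m * _]mulrC divfK// mulrC.
Qed.

(** Along the sides of the triangle [X u0], [X u1], [X u2], the map [Y] has
    increments proportional to those of [X], and closing up the triangle forces
    one common factor [c].  At a further point, a nonzero deviation of
    [Y - c X] would be parallel to the segments towards all three vertices,
    which would make the triangle flat. *)
Lemma parallel_increments_affine (K : fieldType) (T : Type) (U : set T)
    (I : Type) (X Y : T -> I -> K) (i j : I) (u0 u1 u2 : T) :
  (forall v w k l, U v -> U w ->
    (X v k - X w k) * (Y v l - Y w l) = (X v l - X w l) * (Y v k - Y w k)) ->
  U u0 -> U u1 -> U u2 ->
  (X u1 i - X u0 i) * (X u2 j - X u0 j) !=
    (X u1 j - X u0 j) * (X u2 i - X u0 i) ->
  exists (c : K) (b : I -> K), forall v k, U v -> Y v k = b k + c * X v k.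
Proof.
move=> par Uu0 Uu1 Uu2 det.
have ratio v : (X v i - X u0 i != 0) || (X v j - X u0 j != 0) -> U v ->
    exists c, forall m, Y v m - Y u0 m = c * (X v m - X u0 m).
  move=> Xv Uv; have parv m n := par v u0 m n Uv Uu0.
  by case/orP: Xv => Xm; apply: (@parallel_proportional _ _
    (fun m => X v m - X u0 m) (fun m => Y v m - Y u0 m) _ Xm).
have [c c1] : exists c, forall m, Y u1 m - Y u0 m = c * (X u1 m - X u0 m).
  apply: ratio => //; rewrite -negb_and; apply: contraNN det.
  by case/andP => /eqP -> /eqP ->; rewrite !mul0r.
have [c' c2] : exists c, forall m, Y u2 m - Y u0 m = c * (X u2 m - X u0 m).
  apply: ratio => //; rewrite -negb_and; apply: contraNN det.
  by case/andP => /eqP -> /eqP ->; rewrite !mulr0.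
(* The minor for the third side, from [u2] to [u1], is, up to sign, [c' - c]
   times the determinant of the other two. *)
have cc' : c' = c.
  have Y1 m : Y u1 m = Y u0 m + c * (X u1 m - X u0 m).
    by rewrite -c1 addrC subrK.
  have Y2 m : Y u2 m = Y u0 m + c' * (X u2 m - X u0 m).
    by rewrite -c2 addrC subrK.
  have := par u1 u2 i j Uu1 Uu2; rewrite !Y1 !Y2 => par12.
  apply/eqP; rewrite -subr_eq0; rewrite -subr_eq0 in det.
  apply/eqP/(mulIf det); rewrite mul0r; move/eqP: par12.
  by rewrite -subr_eq0 => /eqP par12; rewrite -[RHS]oppr0 -par12; ring.
subst c'; exists c, (fun k => Y u0 k - c * X u0 k) => v k Uv.
pose eta m := Y v m - Y u0 m - c * (X v m - X u0 m).
have [eta0|etak] := eqVneq (eta k) 0.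
  by apply/eqP; rewrite -subr_eq0 -[X in _ == X]eta0 /eta; apply/eqP; ring.
have Xeta u : U u -> (forall m, Y u m - Y u0 m = c * (X u m - X u0 m)) ->
    exists gamma, forall m, X u m = X v m - gamma * eta m.
  move=> Uu cu.
  have [|gamma Xu] := parallel_proportional (b := fun m => X v m - X u m) etak.
    move=> m n; have := par v u m n Uv Uu.
    have Yu l : Y u l = Y u0 l + c * (X u l - X u0 l).
      by rewrite -cu addrC subrK.
    rewrite !Yu => /eqP; rewrite -subr_eq0 => /eqP par_u.
    apply/eqP; rewrite -subr_eq0 -[X in _ == X]oppr0 -par_u /eta.
    by apply/eqP; ring.
  by exists gamma => m; rewrite -Xu opprB addrC subrK.
have [|g0 X0] := Xeta u0 Uu0; first by move=> m; rewrite !subrr mulr0.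
have [g1 X1] := Xeta u1 Uu1 c1; have [g2 X2] := Xeta u2 Uu2 c2.
by case/eqP: det; rewrite !X0 !X1 !X2; ring.
Qed.

(** * Integration on the punctured space *)

(** A point with nonzero coordinate [m] is moved to have coordinate [n] equal to
    1, where [n != m]; coordinate [n] then keeps the path away from the origin
    while the other coordinates are set to 1 one by one. *)
Lemma axis_invariant_constant (R : realType) (d : nat) (T : Type)
    (f : 'rV[R]_d -> T) (i j : 'I_d) :
  i != j ->
  (forall x k, (forall t, punctured (x + t *: delta_mx 0 k)) ->
    forall t, f (x + t *: delta_mx 0 k) = f x) ->
  forall x, punctured x -> f x = f (const_mx 1).
Proof.
move=> ij finv x x0.
have move_axis (y : 'rV[R]_d) (n k : 'I_d) (t : R) : y 0 n != 0 -> n != k ->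
    f (y + t *: delta_mx 0 k) = f y.
  move=> yn nk; apply: finv => s /rowP/(_ n); rewrite !mxE eqxx (negPf nk).
  by rewrite mulr0 addr0 => /eqP; apply/negP.
have [m xm] : exists m, x 0 m != 0.
  apply: contrapT => xm; apply: x0; apply/rowP => m; rewrite mxE.
  by apply/eqP/negP => /negP xm0; apply: xm; exists m.
have [n mn] : exists n, m != n.
  by case: (eqVneq m i) => [->|mi]; [exists j|exists i].
pose x' := x + (1 - x 0 n) *: delta_mx 0 n.
have x'n : x' 0 n = 1 by rewrite !mxE !eqxx mulr1 addrC subrK.
rewrite -(move_axis x m n (1 - x 0 n) xm mn) -/x'; move: x' x'n => x' x'n.
pose y (s : nat) : 'rV[R]_d := \row_k (if (k < s)%N then 1 else x' 0 k).
have yn s : y s 0 n = 1 by rewrite mxE x'n if_same.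
have y_step (k : 'I_d) : y k.+1 = y k + (1 - x' 0 k) *: delta_mx 0 k.
  apply/rowP => l; rewrite !mxE eqxx /= ltnS leq_eqVlt.
  case: (eqVneq l k) => [->|lk]; first by rewrite eqxx ltnn mulr1 addrC subrK.
  by rewrite -val_eqE/= in lk; rewrite (negPf lk) mulr0 addr0.
have fy s : (s <= d)%N -> f (y s) = f (y 0%N).
  elim: s => // s IH sd; rewrite -(IH (ltnW sd)) (y_step (Ordinal sd)) /=.
  case: (eqVneq n (Ordinal sd)) => [<-|nk]; last first.
    by apply: (move_axis _ n); rewrite ?yn ?oner_eq0.
  by rewrite x'n subrr scale0r addr0.
have -> : x' = y 0%N by apply/rowP => k; rewrite [RHS]mxE.
by rewrite -(fy d)//; congr f; apply/rowP => k; rewrite !mxE ltn_ord.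
Qed.

(** Along an axis-parallel line that avoids the origin, [f] grows linearly with
    the same slope as the linear form of coefficients [b], so their difference
    is invariant along such lines. *)
Lemma punctured_affine (R : realType) (d : nat) (f : 'rV[R]_d -> R)
    (b : 'I_d -> R) (i j : 'I_d) :
  i != j ->
  (forall x k, punctured x -> derivable f x (delta_mx 0 k)) ->
  (forall x k, punctured x -> partial k f x = b k) ->
  exists a, forall x, punctured x -> f x = a + \sum_(k < d) b k * x 0 k.
Proof.
move=> ij df partialf.
pose F x := f x - \sum_(k < d) b k * x 0 k.
exists (F (const_mx 1)) => x x0.
rewrite -(axis_invariant_constant (f := F) ij _ x0); first by rewrite subrK.
move=> {x0}x k line t.
have [s _|s _] := @line_mean_value _ _ f x (delta_mx 0 k) t; first exact: df.
have -> : 'D_(delta_mx 0 k) f (x + s *: delta_mx 0 k) = b k.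
  exact: partialf (line s).
move=> fE.
have sumE : \sum_(l < d) b l * (x + t *: delta_mx 0 k) 0 l =
    \sum_(l < d) b l * x 0 l + t * b k.
  rewrite (eq_bigr (fun l => b l * x 0 l + t * (b l * (l == k)%:R))).
    rewrite big_split -mulr_sumr /=; congr (_ + _ * _).
    rewrite (bigD1 k)//= eqxx mulr1 big1 ?addr0// => l /negPf ->.
    by rewrite mulr0.
  by move=> l _; rewrite !mxE eqxx /= mulrDr mulrCA.
rewrite /F sumE; move/eqP: fE; rewrite subr_eq => /eqP ->.
by ring.
Qed.

(** * Collision invariants *)

Lemma is_C1_derivable (R : realType) (d : nat) (U : set 'rV[R]_d)
    (f : 'rV[R]_d -> R) (x : 'rV[R]_d) (k : 'I_d) :
  is_Ck 1 U f -> U x -> derivable f x (delta_mx 0 k).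
Proof. by move=> [_ /(_ k)[df _]] Ux; apply: df. Qed.

Lemma is_C2_C1 (R : realType) (d : nat) (U : set 'rV[R]_d)
    (f : 'rV[R]_d -> R) : is_Ck 2 U f -> is_Ck 1 U f.
Proof. by move=> [cf df]; split=> // k; have [? []] := df k. Qed.

Theorem theorem1p1 (R : realType) (d : nat) (hd : d = 2%N \/ d = 3%N)
  (omega : 'rV[R]_d -> R) (homega : is_Ck 2 (@punctured R d) omega)
  (hind : exists i j : 'I_d, i <> j /\
    linearly_independent_on (@punctured R d)
      [tuple (fun _ => 1); partial i omega; partial j omega])
  (g : 'rV[R]_d -> R) (hg : is_Ck 1 (@punctured R d) g)
  (hcons : forall v vs v' vs' : 'rV[R]_d,
    punctured v -> punctured vs -> punctured v' -> punctured vs' ->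
    v + vs = v' + vs' ->
    omega v + omega vs = omega v' + omega vs' ->
    g v' + g vs' = g v + g vs) :
  exists (a c : R) (b : 'rV[R]_d), forall v : 'rV[R]_d, punctured v ->
    g v = a + \sum_(k < d) b 0 k * v 0 k + c * omega v.
Proof.
have [i [j [/eqP ij]]] := hind.
move=> /noncollinear_triple[u0 [u1 [u2 [Uu0 Uu1 Uu2 det]]]].
have C1omega := is_C2_C1 homega.
have pU := @punctured_open R d.
have dC1 (f : 'rV[R]_d -> R) : is_Ck 1 (@punctured R d) f ->
    forall y, punctured y -> differentiable f y.
  by move=> C1f y; apply: is_C1_differentiable.
have [c [b gradE]] := @parallel_increments_affine _ _ (@punctured R d) _
  (fun v k => partial k omega v) (fun v k => partial k g v) i j u0 u1 u2
  (fun v w k l => collision_derivatives_parallel pU (dC1 _ C1omega) (dC1 _ hg)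
     hcons (delta_mx 0 k) (delta_mx 0 l) (v := v) (w := w)) Uu0 Uu1 Uu2 det.
have dg k v := @is_C1_derivable _ _ _ _ v k hg.
have domega k v := @is_C1_derivable _ _ _ _ v k C1omega.
have [v k v0|v k v0|a gE] :=
    @punctured_affine _ _ (g - c *: omega) b i j ij.
- by apply: derivableB; [exact: dg|apply: derivableZ; exact: domega].
- rewrite /partial deriveB; [|exact: dg|apply: derivableZ; exact: domega].
  rewrite deriveZ; last exact: domega.
  by apply/eqP; rewrite subr_eq; apply/eqP/(gradE _ k v0).
exists a, c, (\row_k b k) => v v0.
under eq_bigr do rewrite mxE.
by rewrite -gE// subrK.
Qed.
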